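(* Fix $(\theta,\beta)\in(0,1)^2$ and $\alpha>0$ such that $\alpha<\eta^{clu}_\theta(\beta)$, and consider the clustering problem in the ARW model with parameters $(\alpha,\beta,\theta)$. As $p\to\infty$: (i) $\mathrm{Hamm}_p(\hat\ell^{(sa)}_*,\alpha,\beta,\theta)\to0$ if $0<\beta<(1-\theta)/2$; (ii) $\mathrm{Hamm}_p(\hat\ell^{(sa)}_N,\alpha,\beta,\theta)\to0$ if $(1-\theta)/2<\beta<1$ and $N=\lceil p\epsilon_p\rceil$.
   Context: ARW model. For each $p$ let $n=n_p=p^\theta$ (treated as an integer), $\epsilon_p=p^{-\beta}$, $\tau_p=p^{-\alpha}$. The labels $\ell_1,\dots,\ell_n$ are i.i.d. uniform on $\{-1,1\}$; the coordinates of $\mu\in\mathbb R^p$ are i.i.d., equal to $\tau_p$ with probability $\epsilon_p$ and to $0$ with probability $1-\epsilon_p$; $Z$ is an $n\times p$ matrix with i.i.d. $N(0,1)$ entries; $\ell,\mu,Z$ are independent. One observes $X=\ell\mu'+Z=[x_1,\dots,x_p]\in\mathbb R^{n\times p}$ (columns $x_j\in\mathbb R^n$). Clustering error. $\mathrm{Hamm}_p(\hat\ell,\alpha,\beta,\theta)=n^{-1}\inf_{\pi\in\Pi}\sum_{i=1}^n P(\hat\ell_i\ne\pi(\ell_i))$, where $\Pi$ is the set of the two permutations of $\{-1,1\}$ and $P$ is over $(\mu,\ell,Z)$. Methods ($\mathrm{sgn}$ acts entrywise on vectors, $\|\cdot\|_1$ is the vector $L^1$-norm). Sparse Aggregation: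 $\hat S^{(sa)}_N$ is a maximizer of $\|\sum_{j\in S}x_j\|_1$ over $S\subset\{1,\dots,p\}$ with $|S|=N$, and $\hat\ell^{(sa)}_N=\mathrm{sgn}(\sum_{j\in\hat S^{(sa)}_N}x_j)$. Simple Aggregation: $\hat\ell^{(sa)}_*=\mathrm{sgn}(\sum_{j=1}^p x_j)$. The curve $\eta^{clu}_\theta$: $$\eta^{clu}_\theta(\beta)=\begin{cases}(1-2\beta)/2,&\beta\le(1-\theta)/2,\\ \theta/2,&(1-\theta)/2\le\beta\le1-\theta,\\ (1-\beta)/2,&\beta\ge1-\theta.\end{cases}$$ *)

(* Defs.v *)
From HB Require Import structures.
From mathcomp Require Import all_boot all_order all_algebra.
From mathcomp Require Import all_classical all_reals all_analysis.

Set Implicit Arguments.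
Unset Strict Implicit.
Unset Printing Implicit Defensive.

Import Order.TTheory GRing.Theory Num.Theory.
Import numFieldNormedType.Exports.

Local Open Scope classical_set_scope.
Local Open Scope ring_scope.

Section Independence.
Context {d : measure_display} {T : measurableType d} {R : realType}.
Context (P : probability T R).

Definition mutually_independent (I : finType) (G : I -> set (set T)) : Prop :=
  forall (J : {set I}) (A : I -> set T),
    (forall i, i \in J -> G i (A i)) ->
    P (\bigcap_(i in [set` J]) A i) = (\prod_(i in J) P (A i))%E.

Definition sigma_rv (X : T -> R) : set (set T) :=
  preimage_set_system setT X measurable.

(* For a finite index type [I], this is the sigma-algebra of the random vector
   (or matrix) with entries [X i]. *)
Definition sigma_family (I : Type) (X : I -> T -> R) : set (set T) :=
  <<s \bigcup_i sigma_rv (X i) >>.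

End Independence.

(* A realization of the ARW model of size (n, p), on some probability space. *)
Record arw_model {d : measure_display} {T : measurableType d} {R : realType}
    (P : probability T R) (n p : nat) (eps tau : R) := ArwModel {
  arw_label : 'I_n -> {RV P >-> R};
  arw_mean : 'I_p -> {RV P >-> R};
  arw_noise : 'I_n * 'I_p -> {RV P >-> R};
  arw_label_law : forall i,
    P [set w | arw_label i w = 1] = (2^-1)%:E /\
    P [set w | arw_label i w = -1] = (2^-1)%:E;
  arw_mean_law : forall j,
    P [set w | arw_mean j w = tau] = eps%:E /\
    P [set w | arw_mean j w = 0] = (1 - eps)%:E;
  arw_noise_law : forall ij (A : set R), measurable A ->
    distribution P (arw_noise ij) A = normal_prob 0 1 A;
  arw_label_indep : mutually_independent P (fun i => sigma_rv (arw_label i));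
  arw_mean_indep : mutually_independent P (fun j => sigma_rv (arw_mean j));
  arw_noise_indep : mutually_independent P (fun ij => sigma_rv (arw_noise ij));
  arw_indep : mutually_independent P
    (tnth [tuple sigma_family arw_label;
                 sigma_family arw_mean;
                 sigma_family arw_noise])
}.

Section Clustering.
Context {d : measure_display} {T : measurableType d} {R : realType}.
Context {P : probability T R} {n p : nat} {eps tau : R}.
Context (M : arw_model P n p eps tau).

Definition label_vec (w : T) : 'cV[R]_n := \col_i arw_label M i w.
Definition mean_vec (w : T) : 'cV[R]_p := \col_j arw_mean M j w.
Definition noise_mx (w : T) : 'M[R]_(n, p) :=
  \matrix_(i, j) arw_noise M (i, j) w.

Definition arw_data (w : T) : 'M[R]_(n, p) :=
  label_vec w *m (mean_vec w)^T + noise_mx w.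

(* The permutations of {-1, 1}, as restrictions of the maps x |-> x
   and x |-> - x. *)
Definition label_perms : set (R -> R) := [set (fun x => x); (fun x => - x)].

Definition mislabeled (lhat : T -> 'cV[R]_n) (perm : R -> R) (i : 'I_n) : set T :=
  [set w | lhat w i 0 <> perm (label_vec w i 0)].

Definition hamm (lhat : T -> 'cV[R]_n) : \bar R :=
  ((n%:R^-1)%:E *
   ereal_inf [set \sum_(i < n) P (mislabeled lhat perm i)
             | perm in label_perms])%E.

End Clustering.

Section Methods.
Context {R : realType} {n p : nat}.
Implicit Types (X : 'M[R]_(n, p)) (S : {set 'I_p}).

Definition l1norm (v : 'cV[R]_n) : R := \sum_i `|v i 0|.

Definition sgn_vec (v : 'cV[R]_n) : 'cV[R]_n := map_mx Num.sg v.

Definition simple_agg X : 'cV[R]_n := sgn_vec (\sum_j col j X).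

Definition sparse_maximizer (N : nat) X S : Prop :=
  #|S| = N /\
  forall S' : {set 'I_p}, #|S'| = N ->
    l1norm (\sum_(j in S') col j X) <= l1norm (\sum_(j in S) col j X).

Definition sparse_agg S X : 'cV[R]_n := sgn_vec (\sum_(j in S) col j X).

End Methods.

Section Calibration.
Context {R : realType}.

Definition arw_eps (beta : R) (p : nat) : R := p%:R `^ (- beta).
Definition arw_tau (alpha : R) (p : nat) : R := p%:R `^ (- alpha).

Definition sparse_size (beta : R) (p : nat) : nat :=
  `|Num.ceil (p%:R * arw_eps beta p)|%N.

Definition eta_clu (theta beta : R) : R :=
  if beta <= (1 - theta) / 2 then (1 - 2 * beta) / 2
  else if beta <= 1 - theta then theta / 2
  else (1 - beta) / 2.

End Calibration.

(* Main.v *)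
Require Import Defs.
From HB Require Import structures.
From mathcomp Require Import all_boot all_order all_algebra.
From mathcomp Require Import all_classical all_reals all_analysis.
From mathcomp Require Import measurable_realfun ring lra.

Set Implicit Arguments.
Unset Strict Implicit.
Unset Printing Implicit Defensive.

Import Order.TTheory GRing.Theory Num.Theory.
Import numFieldNormedType.Exports.

Local Open Scope classical_set_scope.
Local Open Scope ring_scope.

(* Aggregating a set A of columns gives l_i m_A + z_{A,i}, with m_A the sum of
   the means over A and z_{A,i} ~ N(0, |A|).  A misclassified sample needs
   |z_{A,i}| >= m_A, so the number of errors is at most (sum_i |z_{A,i}|) / m_A,
   and everything reduces to bounding sum_i |z_{A,i}|.  Writing it as a maximum
   of Gaussians over sign vectors, a Chernoff bound and a union bound give, for
   any delta > 0 and w.h.p.,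
   - sum_i |z_{A,i}| <= delta n (p eps tau) for A = {1, .., p}, if
     p eps^2 tau^2 -> oo;
   - sum_i |z_{A,i}| <= delta n (N tau) uniformly over |A| = N, if N tau^2 -> oo
     and n tau^2 / ln p -> oo (there are at most 2^n p^N pairs (sign, A)).
   Both are guaranteed by alpha < eta_clu.  In the second case, comparing
   the maximizer with a set of size N containing (or contained in) the support
   of mu shows that the maximizer also has m_A of order N tau; no independence
   between the data and the selected set is used. *)

(** * Change of variables against a density *)

Section Density.
Local Open Scope ereal_scope.
Import HBNNSimple.

(** The hypothesis on [nu] is the conclusion for indicators. Linearity extends it to simple
    functions and monotone convergence to every nonnegative [f]. It serves both to integrate against
    a Gaussian density and to reweight the law of one variable in a product. *)
Lemma ge0_integral_image_density d d' (T : measurableType d)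
    (T' : measurableType d') (R : realType) (mu : {measure set T -> \bar R})
    (nu : {measure set T' -> \bar R}) (X : T -> T')
    (g : T -> R) (f : T' -> R) :
  measurable_fun setT X ->
  measurable_fun setT g -> (forall x, 0 <= g x)%R ->
  measurable_fun setT f -> (forall y, 0 <= f y)%R ->
  (forall A, measurable A -> nu A = \int[mu]_(x in X @^-1` A) (g x)%:E) ->
  \int[nu]_y (f y)%:E = \int[mu]_x (f (X x) * g x)%:E.
Proof.
move=> mX mg g0 mf f0 nuE.
have mEf : measurable_fun setT (fun y => (f y)%:E) by exact/measurable_EFinP.
pose h := nnsfun_approx measurableT mEf.
have hf y : (EFin \o h n) y @[n --> \oo] --> (f y)%:E.
  by apply: (@cvg_nnsfun_approx _ _ _ _ _ _ mEf) => // ? _; rewrite lee_fin.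
have nd_h y : {homo (fun n => h n y) : m n / (m <= n)%N >-> (m <= n)%R}.
  by move=> m n mn; exact/lefP/nd_nnsfun_approx.
have simple n : \int[nu]_y (h n y)%:E = \int[mu]_x (h n (X x) * g x)%:E.
  transitivity (\int[nu]_y \sum_(r \in range (h n))
      (r * \1_(h n @^-1` [set r]) y)%:E).
    by apply: eq_integral => y _; rewrite fimfunE -fsumEFin.
  rewrite ge0_integral_fsum//; last 2 first.
  - by move=> r; apply/measurable_EFinP; exact: measurable_funM.
  - by move=> r y _; exact: nnfun_muleindic_ge0.
  transitivity (\int[mu]_x \sum_(r \in range (h n))
      (r * \1_(h n @^-1` [set r]) (X x) * g x)%:E); last first.
    apply: eq_integral => x _; rewrite fsumEFin//; congr EFin.
    by rewrite [in RHS]fimfunE mulr_fsuml.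
  rewrite ge0_integral_fsum//; last 2 first.
  - move=> r; apply/measurable_EFinP; apply: measurable_funM => //.
    apply: measurable_funM => //.
    have mr : measurable_fun setT (\1_(h n @^-1` [set r]) : T' -> R).
      exact: measurable_indic.
    exact: measurableT_comp mr _.
  - move=> r x _; rewrite EFinM mule_ge0 ?lee_fin//.
    by rewrite -lee_fin; exact: nnfun_muleindic_ge0.
  apply: eq_fsbigr => r rhn.
  have r0 : (0 <= r)%R by move: rhn; rewrite inE => -[t _ <-].
  rewrite integralZl_indic_nnsfun// integral_indic//= setIT nuE//.
  rewrite integral_mkcond -ge0_integralZl//; last 2 first.
  - apply/(measurable_restrictT _ _).1.
      by rewrite -[_ @^-1` _]setTI; exact: mX.
    by apply: measurable_funTS; exact/measurable_EFinP.
  - by move=> x _; apply: erestrict_ge0 => y _; rewrite lee_fin.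
  apply: eq_integral => x _.
  rewrite restrict_EFin -EFinM -mulrA; congr (_ * _)%:E.
  rewrite -[\1__ (X x)]/(\1_(X @^-1` (h n @^-1` [set r])) x) patchE indicE.
  by case: ifPn => _; rewrite ?mul1r ?mul0r.
(* Monotone convergence on both sides of the identity for simple functions; on the right, the factor
   [g] is nonnegative and keeps the sequence increasing. *)
transitivity (limn (fun n => \int[nu]_y (h n y)%:E)).
  rewrite -monotone_convergence//=.
  - by apply: eq_integral => y _; apply/esym/cvg_lim => //; exact: hf.
  - by move=> n; exact/measurable_EFinP.
  - by move=> n y _; rewrite lee_fin.
  - by move=> y _ m n mn; rewrite lee_fin nd_h.
under eq_fun do rewrite simple.
rewrite -monotone_convergence//=.
- apply: eq_integral => x _; apply/cvg_lim => //.
  under eq_fun do rewrite EFinM.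
  by rewrite EFinM; apply: cvgeZr => //; exact: hf.
- move=> n; apply/measurable_EFinP; apply: measurable_funM => //.
  exact: measurableT_comp.
- by move=> n x _; rewrite lee_fin mulr_ge0.
- by move=> x _ m n mn; rewrite lee_fin ler_wpM2r// nd_h.
Qed.

End Density.

(** * Expectation of a product of functions of independent variables *)

Section IndependentProduct.
Context {d : measure_display} {T : measurableType d} {R : realType}.
Context (P : probability T R).

Lemma measurable_prodr (I : Type) (s : seq I) (Q : pred I) (F : I -> T -> R) :
  (forall i, measurable_fun setT (F i)) ->
  measurable_fun setT (fun w => \prod_(i <- s | Q i) F i w).
Proof.
move=> mF; elim: s => [|i s IHs].
  by under eq_fun do rewrite big_nil; exact: measurable_cst.
under eq_fun do rewrite big_cons.
by case: (Q i) => //; exact: measurable_funM.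
Qed.

(* By induction on the number of f_i that are not indicators: once the claim is
   known with f_k replaced by any indicator, the law of X_k under the density
   \prod_(i != k) f_i(X_i) is a multiple of its law under P. *)
Lemma ge0_expectation_prod (I : finType) (X : I -> {RV P >-> R})
    (f : I -> R -> R) :
  mutually_independent P (fun i => sigma_rv (X i)) ->
  (forall i, measurable_fun setT (f i)) -> (forall i x, 0 <= f i x) ->
  (forall i, \int[P]_w (f i (X i w))%:E < +oo)%E ->
  (\int[P]_w (\prod_i f i (X i w))%:E = \prod_i \int[P]_w (f i (X i w))%:E)%E.
Proof.
move=> indep.
suff gen (m : nat) (J : {set I}) (g : I -> R -> R) : (#|J| <= m)%N ->
    (forall i, measurable_fun setT (g i)) -> (forall i x, 0 <= g i x) ->
    (forall i, \int[P]_w (g i (X i w))%:E < +oo)%E ->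
    (forall i, i \notin J -> exists2 A, measurable A & g i = \1_A) ->
    (\int[P]_w (\prod_i g i (X i w))%:E = \prod_i \int[P]_w (g i (X i w))%:E)%E.
  move=> mf f0 foo; apply: (gen #|I| [set: I]%SET) => //; first exact: max_card.
  by move=> i; rewrite inE.
elim: m J g => [|m IHm] J g; first rewrite leqn0 cards_eq0 => /eqP ->.
  move=> _ _ _ gind.
  have {gind} [A /all_and2[mA gA]] : {A : I -> set R &
      forall i, measurable (A i) /\ g i = \1_(A i)}.
    apply: (@choice _ _ (fun i B => measurable B /\ g i = \1_B)) => i.
    by have [|B mB gB] := gind i; [rewrite inE|exists B].
  have mXA i : measurable (X i @^-1` A i).
    by rewrite -[_ @^-1` _]setTI; exact: measurable_funP.
  (* When every factor is an indicator, the product is the indicator of an intersection, and the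
     claim is the definition of independence. *)
  transitivity (P (\bigcap_(i in [set` [set: I]%SET]) (X i @^-1` A i))).
    rewrite -[X in P X]setIT -integral_indic//; last first.
      exact: fin_bigcap_measurable.
    apply: eq_integral => w _; congr EFin.
    under eq_bigr do rewrite gA.
    rewrite indicE; case: (boolP (w \in _)) => wA.
      apply: big1 => i _; rewrite indicE mem_set//.
      by move: wA; rewrite inE => /(_ i); apply; rewrite /= inE.
    have [i wi] : exists i, ~ A i (X i w).
      move/negP : wA; rewrite inE; apply: contra_notP => /forallNP wA i _.
      exact: contrapT (wA i).
    by rewrite (bigD1 i)//= indicE memNset ?mul0r.
  rewrite indep => [|i _]; last by exists (A i) => //; rewrite setTI.
  rewrite big_mkcond/=; apply: eq_bigr => i _; rewrite inE gA.
  by rewrite -[in LHS](setIT (X i @^-1` A i)) -integral_indic.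
move=> leJ mg g0 goo gind.
have [J0|[k kJ]] := set_0Vmem J.
  by apply: (IHm J) => //; rewrite J0 cards0.
have Eg0 i : (0 <= \int[P]_w (g i (X i w))%:E)%E.
  by apply: integral_ge0 => w _; rewrite lee_fin.
pose E i := fine (\int[P]_w (g i (X i w))%:E).
have EE i : (\int[P]_w (g i (X i w))%:E = (E i)%:E)%E.
  by rewrite fineK// ge0_fin_numE.
have c0 : 0 <= \prod_(i | i != k) E i.
  by apply: prodr_ge0 => i _; exact: fine_ge0.
(* The constant is bundled with its sign so that [mscale c] of the law of [X k] is a measure. *)
pose c := NngNum c0.
pose W w := \prod_(i | i != k) g i (X i w).
have mgX i : measurable_fun setT (fun w => g i (X i w)).
  exact: measurableT_comp.
have mW : measurable_fun setT W by exact: measurable_prodr.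
have W0 w : 0 <= W w by exact: prodr_ge0.
have lawE A : measurable A -> (mscale c (distribution P (X k)) A =
    \int[P]_(w in X k @^-1` A) (W w)%:E)%E.
  move=> mA; pose h i := if i == k then \1_A else g i.
  have mXA : measurable (X k @^-1` A).
    by rewrite -[_ @^-1` _]setTI; exact: measurable_funP.
  have hk : (\int[P]_w (h k (X k w))%:E = P (X k @^-1` A))%E.
    rewrite /h eqxx -[in RHS](setIT (X k @^-1` A)) -integral_indic//.
  rewrite integral_mkcond.
  transitivity (\int[P]_w (\prod_i h i (X i w))%:E)%E; last first.
    apply: eq_integral => w _; rewrite patchE (bigD1 k)//=.
    rewrite {1}/h eqxx.
    rewrite -[\1__ (X k w)]/(\1_(X k @^-1` A) w) indicE.
    case: ifPn => _; rewrite ?mul0r// mul1r; congr EFin.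
    by apply: eq_bigr => i /negPf ik; rewrite /h ik.
  rewrite (IHm (J :\ k)%SET h).
  - rewrite (bigD1 k)//= hk muleC; congr (_ * _)%E.
    by rewrite -prodEFin; apply: eq_bigr => i /negPf ik; rewrite /h ik EE.
  - by move: leJ; rewrite (cardsD1 k) kJ.
  - by move=> i; rewrite /h; case: ifP => // _; exact: measurable_indic.
  - by move=> i x; rewrite /h; case: ifP => // _; rewrite indicE.
  - move=> i; case: (eqVneq i k) => [->|/negPf ik]; last by rewrite /h ik.
    by rewrite hk (le_lt_trans (probability_le1 _ _))// ltry.
  - move=> i; rewrite !inE negb_and negbK /h.
    case: (eqVneq i k) => [_ _|_ /= iJ]; last exact: gind.
    by exists A.
transitivity (\int[P]_w (g k (X k w) * W w)%:E)%E.
  by apply: eq_integral => w _; rewrite (bigD1 k).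
rewrite -(ge0_integral_image_density (measurable_funPT (X k)) mW W0
  (mg k) (g0 k) lawE).
rewrite ge0_integral_mscale//; last 2 first.
- exact/measurable_EFinP.
- by move=> x _; rewrite lee_fin.
rewrite ge0_integral_pushforward//; last 2 first.
- exact/measurable_EFinP.
- by move=> x _; rewrite lee_fin.
rewrite (bigD1 k)//= muleC; congr (_ * _)%E.
by rewrite -prodEFin; apply: eq_bigr => i _; rewrite EE.
Qed.

End IndependentProduct.

(** * Chernoff bounds for Gaussian sums and their L1 norms *)

Section GaussianTail.
Context {d : measure_display} {T : measurableType d} {R : realType}.
Context (P : probability T R).

(** Completing the square: [expR (c * x)] times the standard density is [expR (c ^+ 2 / 2)] times
    the density of N(c, 1), which integrates to 1. *)
Lemma expectation_expR_normal (X : {RV P >-> R}) (c : R) :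
  (forall A : set R, measurable A -> distribution P X A = normal_prob 0 1 A) ->
  (\int[P]_w (expR (c * X w))%:E = (expR (c ^+ 2 / 2))%:E)%E.
Proof.
move=> lawX.
have mexp : measurable_fun setT (fun x : R => expR (c * x)).
  by apply: measurableT_comp => //; exact: measurable_funM.
transitivity (\int[distribution P X]_x (expR (c * x))%:E)%E.
  by rewrite ge0_integral_pushforward//; exact/measurable_EFinP.
rewrite (@ge0_integral_image_density _ _ (measurableTypeR R) R R
  lebesgue_measure (distribution P X) id (normal_pdf 0 1)) //=; last 2 first.
- exact: measurable_normal_pdf.
- by move=> x; exact: normal_pdf_ge0.
transitivity (\int[lebesgue_measure]_x
    ((expR (c ^+ 2 / 2))%:E * (normal_pdf c 1 x)%:E))%E.
  apply: eq_integral => x _; rewrite -EFinM; congr EFin.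
  rewrite !normal_pdfE ?oner_eq0// mulrCA [RHS]mulrCA -!expRD.
  by congr (_ * expR _); rewrite expr1n; field.
rewrite ge0_integralZl ?lee_fin ?expR_ge0//; last 2 first.
- by apply/measurable_EFinP; exact: measurable_normal_pdf.
- by move=> x _; rewrite lee_fin normal_pdf_ge0.
by rewrite integral_normal_pdf mule1.
Qed.

Lemma measurable_set_le (f g : T -> R) :
  measurable_fun setT f -> measurable_fun setT g ->
  measurable [set w | f w <= g w].
Proof.
by move=> mf mg; rewrite -[X in measurable X]setTI; exact: measurable_fun_le.
Qed.

(** The indicator of 0 <= Y is pointwise at most exp(Y). Threshold and Chernoff parameter are
    absorbed into [Y]. *)
Lemma markov_expR (Y : T -> R) : measurable_fun setT Y ->
  (P [set w | (0 <= Y w)%R] <= \int[P]_w (expR (Y w))%:E)%E.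
Proof.
move=> mY.
have mA : measurable [set w | 0 <= Y w] by exact: measurable_set_le.
rewrite -[X in P X]setIT -integral_indic//.
apply: ge0_le_integral => //.
- by apply/measurable_EFinP; exact: measurable_indic.
- by apply/measurable_EFinP; exact: measurableT_comp.
- move=> w _; rewrite lee_fin indicE.
  case: (boolP (_ \in _)) => [|_]; last exact: expR_ge0.
  rewrite inE/= => Y0; by rewrite -expR0 ler_expR.
Qed.

(** Chernoff's method: by independence the moment generating function at [lam] is exp(lam^2 v / 2),
    with v the variance of the sum. *)
Lemma gaussian_sum_tail (I : finType) (X : I -> {RV P >-> R}) (c : I -> R)
    (t : R) :
  mutually_independent P (fun i => sigma_rv (X i)) ->
  (forall i (A : set R), measurable A ->
     distribution P (X i) A = normal_prob 0 1 A) ->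
  0 <= t ->
  (P [set w | t <= \sum_i c i * X i w]%R
   <= (expR (- (t ^+ 2 / (2 * \sum_i c i ^+ 2))))%:E)%E.
Proof.
move=> indep lawX t0; set v := \sum_i c i ^+ 2.
pose Y w := \sum_i c i * X i w.
have mY : measurable_fun setT Y.
  by apply: measurable_sum => i; exact: measurable_funM.
have mYt : measurable [set w | t <= Y w] by exact: measurable_set_le.
have v0 : 0 <= v by apply: sumr_ge0 => i _; exact: sqr_ge0.
(* If v = 0, division by zero returns 0 and the claimed bound is the trivial one, 1. *)
have [vz|vN0] := eqVneq v 0.
  by rewrite vz mulr0 invr0 mulr0 oppr0 expR0; exact: probability_le1.
(* This value minimizes lam^2 v / 2 - lam t. *)
pose lam := t / v.
have lam0 : 0 <= lam by rewrite divr_ge0.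
have mlY : measurable_fun setT (fun w => lam * (Y w - t)).
  by apply: measurable_funM => //; exact: measurable_funB.
apply: (@le_trans _ _ (P [set w | 0 <= lam * (Y w - t)])).
  apply: le_measure; rewrite ?inE//; first exact: measurable_set_le.
  by move=> w /= tY; rewrite mulr_ge0// subr_ge0.
apply: (le_trans (markov_expR mlY)).
have mexp i : measurable_fun setT (fun x : R => expR (lam * c i * x)).
  by apply: measurableT_comp => //; exact: measurable_funM.
have Eexp i : (\int[P]_w (expR (lam * c i * X i w))%:E =
    (expR ((lam * c i) ^+ 2 / 2))%:E)%E.
  by apply: expectation_expR_normal => A mA; exact: lawX.
have EY w : expR (lam * (Y w - t)) =
    expR (- (lam * t)) * \prod_i expR (lam * c i * X i w).
  rewrite -expR_sum -expRD; congr expR.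
  rewrite mulrBr addrC mulr_sumr; congr (_ + _).
  by apply: eq_bigr => i _; rewrite mulrA.
under eq_integral do rewrite EY EFinM.
rewrite ge0_integralZl ?lee_fin ?expR_ge0//; last 2 first.
- apply/measurable_EFinP; apply: measurable_prodr => i.
  by apply: (measurableT_comp (mexp i)).
- by move=> w _; rewrite lee_fin; apply: prodr_ge0 => i _; exact: expR_ge0.
rewrite (@ge0_expectation_prod _ _ _ P _ X (fun i x => expR (lam * c i * x)))//;
  last by move=> i; rewrite Eexp ltry.
under eq_bigr do rewrite Eexp.
rewrite prodEFin -EFinM lee_fin -expR_sum -expRD ler_expR.
rewrite le_eqVlt; apply/orP; left; apply/eqP.
under eq_bigr do rewrite exprMn -mulrA.
rewrite -mulr_sumr -mulr_suml -/v /lam.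
by field.
Qed.

Lemma measure_le_sum_cover (I : finType) (A : {set I}) (F : I -> set T)
    (B : set T) :
  measurable B -> (forall i, measurable (F i)) ->
  B `<=` \bigcup_(i in [set` A]) F i -> (P B <= \sum_(i in A) P (F i))%E.
Proof.
move=> mB mF BF; rewrite -big_enum fsbig_seq ?enum_uniq//.
apply: content_sub_fsum => // w /BF[i iA Fiw].
by exists i => //=; rewrite mem_enum.
Qed.

(* An L1 norm is the maximum of 2 ^ n signed sums: union bound over signs and
   over the sets in F. *)
Lemma gaussian_l1_tail (n p : nat) (Z : 'I_n * 'I_p -> {RV P >-> R})
    (F : {set {set 'I_p}}) (k : nat) (t : R) :
  mutually_independent P (fun ij => sigma_rv (Z ij)) ->
  (forall ij (A : set R), measurable A ->
     distribution P (Z ij) A = normal_prob 0 1 A) ->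
  (forall S, S \in F -> #|S| = k) -> 0 <= t ->
  (P (\bigcup_(S in [set` F])
       [set w | t <= \sum_(i < n) `|\sum_(j in S) Z (i, j) w|]%R)
   <= (2 ^+ n * #|F|%:R * expR (- (t ^+ 2 / (2 * (n * k)%N%:R))))%:E)%E.
Proof.
move=> indep lawZ cardF t0.
(* A pair x of a column set and a sign pattern on the rows turns the signed sum into one linear form
   in all n p noise entries. Its variance is n k whenever the column set lies in [F]. *)
pose c (x : {set 'I_p} * {ffun 'I_n -> bool}) (ij : 'I_n * 'I_p) : R :=
  (-1) ^+ x.2 ij.1 * (ij.2 \in x.1)%:R.
pose G x := [set w | t <= \sum_ij c x ij * Z ij w].
have mG x : measurable (G x).
  apply: measurable_set_le => //; apply: measurable_sum => ij.
  exact: measurable_funM.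
have sumE x (w : T) : \sum_ij c x ij * Z ij w =
    \sum_(i < n) (-1) ^+ x.2 i * \sum_(j in x.1) Z (i, j) w.
  rewrite (eq_bigr (fun ij => c x (ij.1, ij.2) * Z (ij.1, ij.2) w)); last first.
    by case.
  rewrite -(pair_bigA _ (fun i j => c x (i, j) * Z (i, j) w))/=.
  apply: eq_bigr => i _; rewrite mulr_sumr [RHS]big_mkcond/=.
  apply: eq_bigr => j _; rewrite /c/=.
  by case: (j \in x.1); rewrite ?mulr1 ?mulr0 ?mul0r.
have sqE x : x.1 \in F -> \sum_ij c x ij ^+ 2 = (n * k)%N%:R.
  move=> xF; rewrite (eq_bigr (fun ij => c x (ij.1, ij.2) ^+ 2)); last by case.
  rewrite -(pair_bigA _ (fun i j => c x (i, j) ^+ 2))/=.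
  rewrite (eq_bigr (fun=> k%:R)) => [|i _].
    by rewrite sumr_const card_ord natrM mulr_natl.
  under eq_bigr do rewrite /c/= exprMn sqrr_sign mul1r.
  rewrite -(cardF _ xF) -sum1_card natr_sum [RHS]big_mkcond/=.
  by apply: eq_bigr => j _; case: (j \in x.1); rewrite ?expr1n ?expr0n.
have mB : measurable (\bigcup_(S in [set` F])
    [set w | t <= \sum_(i < n) `|\sum_(j in S) Z (i, j) w|]).
  apply: fin_bigcup_measurable => // S _; apply: measurable_set_le => //.
  apply: measurable_sum => i; apply: measurableT_comp => //.
  by under eq_fun do rewrite -big_enum; exact: measurable_sum.
have cover : \bigcup_(S in [set` F])
    [set w | t <= \sum_(i < n) `|\sum_(j in S) Z (i, j) w|] `<=`
    \bigcup_(x in [set` finset.setX F [set: {ffun 'I_n -> bool}]%SET]) G x.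
  move=> w [S SF /= tw].
  (* The sign is flipped exactly on the rows with negative sum, so the signed sum equals the L1
     norm. *)
  exists (S, [ffun i => \sum_(j in S) Z (i, j) w < 0]).
    by rewrite /= !inE SF.
  rewrite /G/= sumE/= (le_trans tw)// le_eqVlt; apply/orP; left; apply/eqP.
  apply: eq_bigr => i _; rewrite ffunE.
  case: ltP => /= [/ltr0_norm ->|/ger0_norm ->].
    by rewrite expr1 mulN1r.
  by rewrite expr0 mul1r.
apply: (le_trans (measure_le_sum_cover mB mG cover)).
have le_e x : x \in finset.setX F [set: {ffun 'I_n -> bool}]%SET ->
    (P (G x) <= (expR (- (t ^+ 2 / (2 * (n * k)%N%:R))))%:E)%E.
  rewrite !inE andbT => xF.
  by rewrite -(sqE _ xF); exact: gaussian_sum_tail.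
apply: (le_trans (lee_sum _ le_e)).
rewrite sumEFin lee_fin sumr_const cardsX cardsT card_ffun card_bool card_ord.
by rewrite -[leLHS]mulr_natl natrM natrX [X in X * _]mulrC.
Qed.

End GaussianTail.

(** * Two-point laws and a binomial lower tail *)

Section TwoPointLaws.
Context {d : measure_display} {T : measurableType d} {R : realType}.
Context (P : probability T R).

Lemma measurable_RV_eq (X : {RV P >-> R}) (a : R) :
  measurable [set w | X w = a].
Proof.
have -> : [set w | X w = a] = X @^-1` [set a] by [].
by rewrite -[X in measurable X]setTI; exact: measurable_funPT.
Qed.

(** The model prescribes only the masses of the two atoms, so a label or a mean may take another
    value on a null set; this lemma lets that set be discarded. *)
Lemma two_point_support (X : {RV P >-> R}) (a b q : R) : a != b ->
  P [set w | X w = a] = q%:E -> P [set w | X w = b] = (1 - q)%:E ->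
  P (~` ([set w | X w = a] `|` [set w | X w = b])) = 0%E.
Proof.
move=> ab Pa Pb.
have ma := measurable_RV_eq X a; have mb := measurable_RV_eq X b.
have PU : P ([set w | X w = a] `|` [set w | X w = b]) = 1%E.
  transitivity (P [set w | X w = a] + P [set w | X w = b])%E.
    apply: measureU => //; apply/seteqP; split => // w /= [-> ba].
    by move/eqP : ab.
  by rewrite Pa Pb -EFinD addrC subrK.
by rewrite probability_setC ?PU ?subee//; exact: measurableU.
Qed.

(** Chernoff's method with parameter 1: each factor has E exp(-1_A) <= 1 - q/2 <= exp(-q/2), and
    exp(pq/4) exp(-pq/2) = exp(-pq/4). *)
Lemma binomial_lower_tail (p : nat) (X : 'I_p -> {RV P >-> R}) (a q : R) :
  mutually_independent P (fun j => sigma_rv (X j)) ->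
  (forall j, P [set w | X j w = a] = q%:E) ->
  (P [set w | \sum_j \1_[set a] (X j w) <= p%:R * q / 4]%R
   <= (expR (- (p%:R * q / 4)))%:E)%E.
Proof.
move=> indep PX.
have m1 : measurable_fun setT (\1_[set a] : R -> R).
  by apply: measurable_indic; exact: measurable_set1.
pose f (j : 'I_p) (x : R) : R := expR (- \1_[set a] x).
have mf j : measurable_fun setT (f j).
  by apply: measurableT_comp => //; exact: measurableT_comp.
have f0 j x : 0 <= f j x by exact: expR_ge0.
have Ef j : (\int[P]_w (f j (X j w))%:E <= (expR (- (q / 2)))%:E)%E.
  have mA := measurable_RV_eq (X j) a.
  have mIA : measurable_fun setT (fun w => \1_[set a] (X j w) : R).
    exact: measurableT_comp.
  have EA : (\int[P]_w (2^-1 * \1_[set w | X j w = a] w)%:E = (q / 2)%:E)%E.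
    under eq_integral do rewrite EFinM.
    rewrite ge0_integralZl ?lee_fin ?invr_ge0//.
      rewrite integral_indic// setIT [in RHS]mulrC EFinM; congr (_ * _)%E.
      exact: PX.
    by apply/measurable_EFinP; exact: measurable_indic.
  (* pointwise, exp (- 1_A) + 1_A / 2 <= 1 *)
  have sumle : (\int[P]_w (f j (X j w))%:E + (q / 2)%:E <= 1)%E.
    have mf1 : measurable_fun setT (fun w => (f j (X j w))%:E).
      by apply/measurable_EFinP; exact: measurableT_comp.
    have mf2 : measurable_fun setT
        (fun w => (2^-1 * \1_[set w | X j w = a] w : R)%:E).
      by apply/measurable_EFinP; exact: measurable_funM.
    have f20 w : (0 <= (2^-1 * \1_[set w | X j w = a] w : R)%:E)%E.
      by rewrite lee_fin mulr_ge0.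
    rewrite -EA -ge0_integralD//; last by move=> w _; rewrite lee_fin.
    rewrite -(probability_setT P) -[leRHS]mul1e -integral_cst//.
    apply: ge0_le_integral => //.
    - by move=> w _; rewrite adde_ge0// lee_fin.
    - exact: emeasurable_funD.
    - move=> w _; rewrite /= -EFinD lee_fin /f.
      rewrite -[\1_[set a] _]/(\1_[set w | X j w = a] w) indicE.
      case: (_ \in _) => /=; last by rewrite oppr0 expR0 mulr0 addr0.
      rewrite mulr1 expRN.
      suff : (expR 1)^-1 <= 2^-1 :> R by lra.
      by rewrite lef_pV2 ?posrE ?expR_gt0// -[leLHS]/(1 + 1) expR_ge1Dx.
  have : (\int[P]_w (f j (X j w))%:E <= (1 - q / 2)%:E)%E.
    by rewrite EFinB leeBrDr.
  move=> /le_trans; apply; rewrite lee_fin.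
  by have := expR_ge1Dx (- (q / 2)).
have mK : measurable_fun setT (fun w => \sum_j \1_[set a] (X j w) : R).
  by apply: measurable_sum => j; exact: measurableT_comp.
have mY : measurable_fun setT
    (fun w => p%:R * q / 4 - \sum_j \1_[set a] (X j w)).
  exact: measurable_funB.
have -> : [set w | \sum_j \1_[set a] (X j w) <= p%:R * q / 4] =
    [set w | 0 <= p%:R * q / 4 - \sum_j \1_[set a] (X j w)].
  by apply/seteqP; split => w /=; rewrite subr_ge0.
apply: (le_trans (markov_expR P mY)).
have EY w : expR (p%:R * q / 4 - \sum_j \1_[set a] (X j w)) =
    expR (p%:R * q / 4) * \prod_j f j (X j w).
  by rewrite -expR_sum -expRD sumrN.
under eq_integral do rewrite EY EFinM.
have mfX j : measurable_fun setT (fun w => f j (X j w)).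
  exact: measurableT_comp.
rewrite ge0_integralZl ?lee_fin ?expR_ge0//; last 2 first.
- by apply/measurable_EFinP; exact: measurable_prodr.
- by move=> w _; rewrite lee_fin; exact: prodr_ge0.
rewrite ge0_expectation_prod//; last first.
  by move=> j; rewrite (le_lt_trans (Ef j))// ltry.
have E0 j : (0 <= \int[P]_w (f j (X j w))%:E)%E.
  by apply: integral_ge0 => w _; rewrite lee_fin.
have EE j : (\int[P]_w (f j (X j w))%:E =
    (fine (\int[P]_w (f j (X j w))%:E))%:E)%E.
  by rewrite fineK// ge0_fin_numE// (le_lt_trans (Ef j))// ltry.
under eq_bigr do rewrite EE.
rewrite prodEFin -EFinM lee_fin.
apply: (@le_trans _ _ (expR (p%:R * q / 4) * expR (- (q / 2)) ^+ p)).
  rewrite ler_wpM2l ?expR_ge0//.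
  have -> : expR (- (q / 2)) ^+ p = \prod_(j < p) expR (- (q / 2)).
    by rewrite prodr_const card_ord.
  apply: ler_prod => j _; rewrite fine_ge0//=.
  by rewrite -lee_fin -EE.
rewrite -expRM_natl -expRD ler_expR.
by rewrite le_eqVlt; apply/orP; left; apply/eqP; field.
Qed.

End TwoPointLaws.

(** * From error counts to the Hamming error *)

Section Clustering.
Context {d : measure_display} {T : measurableType d} {R : realType}.
Context {P : probability T R} {n p : nat} {eps tau : R}.
Context (M : arw_model P n p eps tau).

Lemma sg_neq_label (l m z : R) : l = 1 \/ l = -1 -> 0 < m ->
  Num.sg (l * m + z) <> l -> m <= `|z|.
Proof.
move=> l1 m0; apply: contra_notP => /negP; rewrite -ltNge ltr_norml => /andP[].
case: l1 => -> mz zm.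
  by rewrite mul1r gtr0_sg//; lra.
by rewrite mulN1r ltr0_sg//; lra.
Qed.

Lemma sum_col_arw_data (S : {set 'I_p}) (w : T) (i : 'I_n) :
  (\sum_(j in S) col j (arw_data M w)) i 0 =
  arw_label M i w * \sum_(j in S) arw_mean M j w
  + \sum_(j in S) arw_noise M (i, j) w.
Proof.
rewrite summxE mulr_sumr -big_split/=; apply: eq_bigr => j _.
by rewrite !mxE big_ord1 !mxE.
Qed.

Lemma measurable_sgr : measurable_fun setT (@Num.sg R).
Proof.
have -> : @Num.sg R = (fun x =>
    \1_(`]0, +oo[%classic : set R) x - \1_(`]-oo, 0[%classic : set R) x).
  apply/funext => x; rewrite !indicE !mem_setE !in_itv/= andbT.
  case: (ltrgtP x 0) => [x0|x0|->] /=; first by rewrite ltr0_sg// sub0r.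
    by rewrite gtr0_sg// subr0.
  by rewrite sgr0 subrr.
by apply: measurable_funB; exact: measurable_indic.
Qed.

(** The event is split along the finitely many values of [S]; on each piece the aggregated set is
    fixed and the sign is a measurable function. *)
Lemma measurable_mislabeled_sparse_agg (S : T -> {set 'I_p}) (i : 'I_n) :
  (forall A, measurable [set w | S w = A]) ->
  measurable (mislabeled M (fun w => sparse_agg (S w) (arw_data M w))
    (fun x => x) i).
Proof.
move=> mS.
have -> : mislabeled M (fun w => sparse_agg (S w) (arw_data M w))
    (fun x => x) i =
  \bigcup_(A in [set: {set 'I_p}]) ([set w | S w = A] `&`
    ~` [set w | Num.sg (arw_label M i w * \sum_(j in A) arw_mean M j w
                 + \sum_(j in A) arw_noise M (i, j) w) = arw_label M i w]).
  apply/seteqP; split => [w|w [A _ [/= <-]]].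
    by rewrite /mislabeled /= !mxE sum_col_arw_data => neq; exists (S w).
  by rewrite /mislabeled /= !mxE sum_col_arw_data.
apply: fin_bigcup_measurable => // A _; apply: measurableI => //.
apply: measurableC.
have msum (f : 'I_p -> {RV P >-> R}) :
    measurable_fun setT (fun w => \sum_(j in A) f j w).
  by under eq_fun do rewrite -big_enum; exact: measurable_sum.
have msg : measurable_fun setT (fun w =>
    Num.sg (arw_label M i w * \sum_(j in A) arw_mean M j w
                 + \sum_(j in A) arw_noise M (i, j) w)).
  apply: (measurableT_comp measurable_sgr); apply: measurable_funD => //.
  exact: measurable_funM.
rewrite set_eq_le; apply: measurableI; exact: measurable_set_le.
Qed.

Lemma hamm_ge0 (lhat : T -> 'cV[R]_n) : (0 <= hamm M lhat)%E.
Proof.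
apply: mule_ge0; first by rewrite lee_fin invr_ge0.
by apply: le_ereal_inf_tmp => _ [f _ <-]; apply: sume_ge0.
Qed.

(** The infimum is bounded by its value at the identity permutation. The expected number of errors
    is then at most kappa n from outside [E] plus n P(E). *)
Lemma hamm_le (lhat : T -> 'cV[R]_n) (E : set T) (kappa : R) :
  (forall i, measurable (mislabeled M lhat (fun x => x) i)) -> measurable E ->
  0 <= kappa ->
  (forall w, ~ E w ->
     \sum_(i < n) \1_(mislabeled M lhat (fun x => x) i) w <= kappa * n%:R) ->
  (hamm M lhat <= kappa%:E + P E)%E.
Proof.
move=> mmis mE k0 good.
(* For n = 0 the convention 1/0 = 0 makes the Hamming error 0. *)
have [n0|n0] := posnP n.
  rewrite /hamm (_ : n%:R^-1 = 0) ?n0 ?invr0// mul0e.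
  by rewrite adde_ge0 ?lee_fin.
set mis := mislabeled M lhat (fun x => x) in mmis good *.
have le_inf : (hamm M lhat <= (n%:R^-1)%:E * \sum_(i < n) P (mis i))%E.
  rewrite /hamm; apply: lee_wpmul2l; first by rewrite lee_fin invr_ge0.
  by apply: ereal_inf_lbound; exists (fun x => x) => //; left.
apply: (le_trans le_inf).
rewrite muleC lee_pdivrMr ?ltr0n//.
have mis1 i : measurable_fun setT (fun w => (\1_(mis i) w : R)%:E).
  by apply/measurable_EFinP; exact: measurable_indic.
have -> : (\sum_(i < n) P (mis i) =
    \int[P]_w (\sum_(i < n) (\1_(mis i) w : R)%:E))%E.
  rewrite ge0_integral_sum//.
  by apply: eq_bigr => i _; rewrite integral_indic// setIT.
have mE1 : measurable_fun setT (fun w => (\1_E w : R)%:E).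
  by apply/measurable_EFinP; exact: measurable_indic.
have mnE1 : measurable_fun setT (fun w => (n%:R%:E * (\1_E w : R)%:E)%E).
  exact: measurable_funeM.
have kn0 : (0 <= (kappa * n%:R)%:E)%E by rewrite lee_fin mulr_ge0.
have nE0 w : (0 <= n%:R%:E * (\1_E w : R)%:E)%E by rewrite mule_ge0// lee_fin.
have -> : ((kappa%:E + P E) * n%:R%:E =
    \int[P]_w ((kappa * n%:R)%:E + n%:R%:E * (\1_E w : R)%:E))%E.
  have I1 : (\int[P]_w (kappa * n%:R)%:E = (kappa * n%:R)%:E)%E.
    rewrite integral_cst// -[RHS]mule1; congr (_ * _)%E.
    exact: probability_setT.
  have I2 : (\int[P]_w (\1_E w : R)%:E = P E)%E.
    by rewrite integral_indic// setIT.
  rewrite ge0_integralD// I1 ge0_integralZl//.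
  by rewrite I2 ge0_muleDl// -EFinM [in RHS]muleC.
apply: ge0_le_integral => //.
- by move=> w _; apply: sume_ge0 => i _; rewrite lee_fin.
- exact: emeasurable_sum.
- exact: emeasurable_funD.
- move=> w _; rewrite sumEFin -EFinM -EFinD lee_fin [in X in _ <= _ + X]indicE.
  case: (boolP (w \in E)) => [_|/negP wE]; rewrite ?mulr1 ?mulr0 ?addr0.
    apply: (@le_trans _ _ n%:R); last by rewrite lerDr mulr_ge0.
    rewrite -[n in leRHS]card_ord -sum1_card natr_sum; apply: ler_sum => i _.
    by rewrite indicE; case: (_ \in _).
  by apply: good => Ew; apply: wE; rewrite inE.
Qed.

End Clustering.

(** * Error bound for aggregation over a data-dependent set *)

Section SparseAggregationBound.
Context {d : measure_display} {T : measurableType d} {R : realType}.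
Context {P : probability T R} {n p : nat} {eps tau : R}.
Context (M : arw_model P n p eps tau).

(** Common core of both methods. The noise is controlled uniformly over [F], so [S] may depend on
    the data in any measurable way. The lower bound [m] on the selected means is required only on
    the good event, where fewer than t noise spread over errors costing m each leaves at most t / m
    <= kappa n errors. *)
Lemma hamm_sparse_agg_le (F : {set {set 'I_p}}) (k : nat)
    (S : T -> {set 'I_p}) (t m kappa : R) :
  (forall A, measurable [set w | S w = A]) ->
  (forall A, A \in F -> #|A| = k) -> (forall w, S w \in F) ->
  0 < tau -> 0 <= t -> 0 < m -> 0 <= kappa -> t <= kappa * n%:R * m ->
  (forall w, (forall i, arw_label M i w = 1 \/ arw_label M i w = -1) ->
     (forall j, arw_mean M j w = tau \/ arw_mean M j w = 0) ->
     p%:R * eps / 4 < \sum_j \1_[set tau] (arw_mean M j w) ->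
     (forall A, A \in F ->
        \sum_(i < n) `|\sum_(j in A) arw_noise M (i, j) w| < t) ->
     m <= \sum_(j in S w) arw_mean M j w) ->
  (hamm M (fun w => sparse_agg (S w) (arw_data M w)) <=
   (kappa + 2 ^+ n * #|F|%:R * expR (- (t ^+ 2 / (2 * (n * k)%N%:R)))
    + expR (- (p%:R * eps / 4)))%:E)%E.
Proof.
move=> mS cardF SF tau0 t0 m0 kappa0 tm signal.
(* The bad event has four parts: [E1] and [E2] are the null sets of labels or means off their two
   values, [E3] is a shortage of nonzero means, and [E4] is a large noise norm for some set in
   [F]. *)
pose N1 i := ~`
  ([set w | arw_label M i w = 1] `|` [set w | arw_label M i w = -1]).
pose N2 j := ~`
  ([set w | arw_mean M j w = tau] `|` [set w | arw_mean M j w = 0]).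
pose E1 := \bigcup_(i in [set` [set: 'I_n]%SET]) N1 i.
pose E2 := \bigcup_(j in [set` [set: 'I_p]%SET]) N2 j.
pose E3 := [set w | \sum_j \1_[set tau] (arw_mean M j w) <= p%:R * eps / 4].
pose E4 := \bigcup_(A in [set` F])
  [set w | t <= \sum_(i < n) `|\sum_(j in A) arw_noise M (i, j) w|].
have mN1 i : measurable (N1 i).
  by apply: measurableC; apply: measurableU; exact: measurable_RV_eq.
have mN2 j : measurable (N2 j).
  by apply: measurableC; apply: measurableU; exact: measurable_RV_eq.
have mE1 : measurable E1 by exact: fin_bigcup_measurable.
have mE2 : measurable E2 by exact: fin_bigcup_measurable.
have mE3 : measurable E3.
  apply: measurable_set_le => //; apply: measurable_sum => j.
  by apply: (measurableT_comp (measurable_indic (measurable_set1 tau))).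
have mE4 : measurable E4.
  apply: fin_bigcup_measurable => // A _; apply: measurable_set_le => //.
  apply: measurable_sum => i; apply: measurableT_comp => //.
  by under eq_fun do rewrite -big_enum; exact: measurable_sum.
have PE1 : (P E1 <= 0)%E.
  apply: (le_trans (measure_le_sum_cover P mE1 mN1 (fun _ x => x))).
  rewrite big1// => i _; have [l1 l2] := arw_label_law M i.
  apply: (@two_point_support _ _ _ P _ _ _ (2^-1)) => //.
    by apply/eqP => ?; lra.
  by rewrite l2; congr EFin; lra.
have PE2 : (P E2 <= 0)%E.
  apply: (le_trans (measure_le_sum_cover P mE2 mN2 (fun _ x => x))).
  rewrite big1// => j _; have [l1 l2] := arw_mean_law M j.
  by apply: two_point_support l1 l2; rewrite gt_eqF.
have PE3 : (P E3 <= (expR (- (p%:R * eps / 4)))%:E)%E.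
  apply: binomial_lower_tail; first exact: arw_mean_indep.
  by move=> j; have [] := arw_mean_law M j.
have PE4 := gaussian_l1_tail (@arw_noise_indep _ _ _ _ _ _ _ _ M)
  (@arw_noise_law _ _ _ _ _ _ _ _ M) cardF t0.
have mE : measurable (E1 `|` E2 `|` (E3 `|` E4)).
  by apply: measurableU; exact: measurableU.
have PE : (P (E1 `|` E2 `|` (E3 `|` E4)) <=
    (2 ^+ n * #|F|%:R * expR (- (t ^+ 2 / (2 * (n * k)%N%:R)))
    + expR (- (p%:R * eps / 4)))%:E)%E.
  apply: (le_trans (measureU2 _ _ _)); [exact: measurableU..|].
  rewrite -[leRHS]add0e; apply: leeD.
    by rewrite -[leRHS]adde0 (le_trans (measureU2 _ _ _))// leeD.
  by rewrite EFinD addeC (le_trans (measureU2 _ _ _))// leeD.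
apply: (@le_trans _ _ (kappa%:E + P (E1 `|` E2 `|` (E3 `|` E4)))%E); last first.
  by rewrite -addrA EFinD leeD2l.
apply: hamm_le => // [i|w /not_orP[/not_orP[nE1 nE2] /not_orP[nE3 nE4]]].
  exact: measurable_mislabeled_sparse_agg.
have lab i : arw_label M i w = 1 \/ arw_label M i w = -1.
  by apply: contrapT => nl; apply: nE1; exists i; rewrite /= ?inE.
have means j : arw_mean M j w = tau \/ arw_mean M j w = 0.
  by apply: contrapT => nl; apply: nE2; exists j; rewrite /= ?inE.
have count : p%:R * eps / 4 < \sum_j \1_[set tau] (arw_mean M j w).
  by rewrite ltNge; apply/negP.
have noise A : A \in F ->
    \sum_(i < n) `|\sum_(j in A) arw_noise M (i, j) w| < t.
  by move=> AF; rewrite ltNge; apply/negP => tA; apply: nE4; exists A.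
have mSw := signal w lab means count noise.
(* every misclassified sample contributes at least m to the noise *)
rewrite -(ler_pM2r m0); apply: le_trans tm.
apply: le_trans (ltW (noise _ (SF w))).
rewrite mulr_suml; apply: ler_sum => i _; rewrite indicE.
case: (boolP (w \in _)) => [|_]; last by rewrite mul0r.
rewrite inE mul1r /mislabeled /= !mxE sum_col_arw_data => neq.
apply: (le_trans mSw); apply: sg_neq_label neq => //.
exact: lt_le_trans mSw.
Qed.

End SparseAggregationBound.

(** * Counting and choosing sets of columns *)

Lemma bin_le_expn (p N : nat) : ('C(p, N) <= p ^ N)%N.
Proof.
apply: (@leq_trans (p ^_ N)); first by rewrite -bin_ffact leq_pmulr ?fact_gt0.
elim: N p => [|N IHN] [|p]//; rewrite ffactnS expnS leq_mul//=.
rewrite (leq_trans (IHN p))//.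
by case: N {IHN} => // N; rewrite leq_exp2r.
Qed.

(** Supplies the competitor to the maximizer, with [G] the support of the mean vector: being
    comparable with [G], the set [A] meets it in min(N, #|G|) points, the most possible. *)
Lemma set_of_card_comparable (T : finType) (G : {set T}) (N : nat) :
  (N <= #|T|)%N ->
  exists2 A : {set T}, #|A| = N & (A \subset G) || (G \subset A).
Proof.
have sub (B : {set T}) k : (k <= #|B|)%N ->
    exists2 A : {set T}, #|A| = k & A \subset B.
  elim: k => [|k IHk] kB.
    by exists finset.set0; rewrite ?cards0 ?finset.sub0set.
  have [A Ak AB] := IHk (ltnW kB).
  have /set0Pn[x] : (B :\: A)%SET != finset.set0.
    apply: contraTneq kB => /eqP; rewrite finset.setD_eq0 => /subset_leq_card.
    by rewrite Ak -leqNgt.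
  rewrite finset.in_setD => /andP[xA xB]; exists (x |: A)%SET.
    by rewrite cardsU1 xA Ak.
  by rewrite finset.subUset finset.sub1set xB.
move=> NT; case: (leqP N #|G|) => [/sub[A AN AG]|GN].
  by exists A; rewrite ?AG.
(* When [G] is too small, it is completed by points of its complement. *)
have [|A AN AG] := sub (~: G)%SET (N - #|G|)%N.
  by rewrite leq_subLR cardsC.
exists (A :|: G)%SET; last by rewrite finset.subsetUr orbT.
rewrite cardsU AN (_ : A :&: G = finset.set0)%SET ?cards0 ?subn0 ?subnK//.
  exact: ltnW.
by apply/eqP; rewrite finset.setI_eq0 finset.disjoints_subset.
Qed.

(** * Nonasymptotic bounds for the two methods *)

Section Bounds.
Context {d : measure_display} {T : measurableType d} {R : realType}.
Context {P : probability T R} {n p : nat} {eps tau : R}.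
Context (M : arw_model P n p eps tau).

Lemma indic_set1 (x : R) : \1_[set tau] x = (x == tau)%:R :> R.
Proof.
by rewrite indicE; congr (nat_of_bool _)%:R; apply/idP/eqP; rewrite inE.
Qed.

Lemma two_valued_indic (x : R) : x = tau \/ x = 0 -> x = tau * \1_[set tau] x.
Proof.
rewrite indic_set1; case: eqP => [->|]; first by rewrite mulr1.
by rewrite mulr0 => neq [].
Qed.

Lemma hamm_simple_agg_le (delta : R) :
  (0 < p)%N -> 0 < eps -> 0 < tau -> 0 < delta ->
  (hamm M (fun w => simple_agg (arw_data M w)) <=
   (4 * delta + 2 ^+ n *
      expR (- (delta ^+ 2 * n%:R * (p%:R * eps * (eps * tau ^+ 2)) / 2))
    + expR (- (p%:R * eps / 4)))%:E)%E.
Proof.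
move=> p_gt0 eps0 tau0 delta0.
have -> : (fun w => simple_agg (arw_data M w)) =
    (fun w => sparse_agg [set: 'I_p]%SET (arw_data M w)).
  apply/funext => w; rewrite /simple_agg /sparse_agg; congr sgn_vec.
  by apply: eq_bigl => j; rewrite inE.
have p0 : p%:R != 0 :> R by rewrite pnatr_eq0 -lt0n.
(* The family is the single full set. More than p eps / 4 nonzero means give m = p eps tau / 4, so
   the noise level t = delta n p eps tau corresponds to kappa = 4 delta. *)
apply: (le_trans (@hamm_sparse_agg_le _ _ _ _ _ _ _ _ M [set [set: 'I_p]]%SET p
  (fun=> [set: 'I_p]%SET) (delta * n%:R * (p%:R * eps) * tau)
  (p%:R * eps / 4 * tau) (4 * delta) _ _ _ tau0 _ _ _ _ _)).
- move=> A; have [->|TA] := eqVneq A [set: 'I_p]%SET.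
    by rewrite (_ : [set _ | _] = setT)//; exact/seteqP.
  rewrite (_ : [set _ | _] = set0)//; apply/seteqP; split => // w /= Aw.
  by rewrite -Aw eqxx in TA.
- by move=> A; rewrite inE => /eqP ->; rewrite cardsT card_ord.
- by move=> w; rewrite inE.
- by rewrite !mulr_ge0// ltW.
- by rewrite !mulr_gt0// ltr0n.
- by rewrite mulr_ge0// ltW.
- by rewrite le_eqVlt; apply/orP; left; apply/eqP; field.
- move=> w _ means count _.
  rewrite (eq_bigr (fun j => tau * \1_[set tau] (arw_mean M j w))) => [|j _].
    rewrite -mulr_sumr mulrC ler_wpM2l ?(ltW tau0)// (eq_bigl xpredT).
      exact: ltW.
    by move=> j; rewrite inE.
  exact: two_valued_indic.
rewrite lee_fin cards1 mulr1 lerD2r lerD2l ler_wpM2l ?exprn_ge0//.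
rewrite ler_expR lerN2.
have [->|n0] := eqVneq n%:R (0 : R).
  by rewrite !(mulr0, mul0r) expr0n mul0r.
rewrite natrM le_eqVlt; apply/orP; left; apply/eqP; field.
by rewrite n0 p0.
Qed.

(** Since |l_i m| = m for every row, the triangle inequality pins the L1 norm to n m up to the total
    noise. Maximality of the norm thus becomes a comparison of sums of means. *)
Lemma l1norm_sum_le (A : {set 'I_p}) (w : T) :
  (forall i, arw_label M i w = 1 \/ arw_label M i w = -1) ->
  let m := \sum_(j in A) arw_mean M j w in
  let z := \sum_(i < n) `|\sum_(j in A) arw_noise M (i, j) w| in
  0 <= m ->
  n%:R * m - z <= l1norm (\sum_(j in A) col j (arw_data M w)) <= n%:R * m + z.
Proof.
move=> lab m z m0.
have norm_lab i : `|arw_label M i w * m| = m.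
  by case: (lab i) => ->; rewrite ?mul1r ?mulN1r ?normrN ger0_norm.
have sum_m : n%:R * m = \sum_(i < n) `|arw_label M i w * m|.
  by under eq_bigr do rewrite norm_lab; rewrite sumr_const card_ord mulr_natl.
rewrite sum_m -sumrB -big_split/=; apply/andP; split; apply: ler_sum => i _.
  by rewrite sum_col_arw_data lerB_normD.
by rewrite sum_col_arw_data ler_normD.
Qed.

Lemma hamm_sparse_maximizer_le (N : nat) (S : T -> {set 'I_p}) (delta : R) :
  (0 < n)%N -> (0 < N <= p)%N -> N%:R <= 2 * (p%:R * eps) -> 0 < tau ->
  0 < delta <= 32^-1 ->
  (forall A, measurable [set w | S w = A]) ->
  (forall w, sparse_maximizer N (arw_data M w) (S w)) ->
  (hamm M (fun w => sparse_agg (S w) (arw_data M w)) <=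
   (16 * delta + 2 ^+ n * p%:R ^+ N *
      expR (- (delta ^+ 2 * n%:R * (N%:R * tau ^+ 2) / 2))
    + expR (- (p%:R * eps / 4)))%:E)%E.
Proof.
move=> n0 /andP[N0 Np] Npe tau0 /andP[delta0 delta32] mS maxS.
have nR0 : 0 < n%:R :> R by rewrite ltr0n.
have NR0 : 0 < N%:R :> R by rewrite ltr0n.
have [n_ge0 N_ge0 tau_ge0 delta_ge0] : [/\ 0 <= n%:R :> R, 0 <= N%:R :> R,
  0 <= tau & 0 <= delta] by split; exact: ltW.
(* The noise level is t = delta n N tau and the signal is m = N tau / 16, hence kappa = 16 delta. *)
apply: (le_trans (@hamm_sparse_agg_le _ _ _ _ _ _ _ _ M
  [set A : {set 'I_p} | #|A| == N]%SET N S (delta * n%:R * N%:R * tau)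
  (N%:R * tau / 16) (16 * delta) mS _ _ tau0 _ _ _ _ _)).
- by move=> A; rewrite inE => /eqP.
- by move=> w; rewrite inE; apply/eqP; case: (maxS w).
- by rewrite !mulr_ge0.
- by rewrite divr_gt0// mulr_gt0.
- by rewrite mulr_ge0.
- by rewrite le_eqVlt; apply/orP; left; apply/eqP; field.
- move=> w lab means count noise; have [SN maxSw] := maxS w.
  pose G := [set j : 'I_p | arw_mean M j w == tau]%SET.
  have mean_sum (A : {set 'I_p}) :
      \sum_(j in A) arw_mean M j w = tau * #|A :&: G|%:R.
    rewrite (eq_bigr (fun j => tau * \1_[set tau] (arw_mean M j w))) => [|j _].
      rewrite -mulr_sumr; congr (_ * _); rewrite -sum1_card natr_sum.
      rewrite big_mkcond [RHS]big_mkcond/=; apply: eq_bigr => j _.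
      by rewrite !inE indic_set1; case: (j \in A) => //=; case: eqP.
    exact: two_valued_indic.
  have cardG : #|G|%:R = \sum_j \1_[set tau] (arw_mean M j w) :> R.
    rewrite -sum1_card natr_sum big_mkcond/=; apply: eq_bigr => j _.
    by rewrite !inE indic_set1; case: eqP.
  have [|A AN AG] := @set_of_card_comparable 'I_p G N.
    by rewrite card_ord.
  (* The intersection is [A], of size N, or [G], of size more than p eps / 4 >= N / 8. *)
  have AG8 : N%:R / 8 <= #|A :&: G|%:R :> R.
    case/orP : AG => [/finset.setIidPl ->|/finset.setIidPr ->].
      by rewrite AN; lra.
    by rewrite cardG; lra.
  have mean_ge0 (B : {set 'I_p}) : 0 <= \sum_(j in B) arw_mean M j w.
    by rewrite mean_sum mulr_ge0.
  have /andP[leA _] := l1norm_sum_le lab (mean_ge0 A).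
  have /andP[_ leS] := l1norm_sum_le lab (mean_ge0 (S w)).
  have nA := noise A; rewrite inE AN eqxx in nA.
  have nS := noise (S w); rewrite inE SN eqxx in nS.
  (* Writing m_A, z_A for the sum of means and the noise norm of A, maximality gives n m_S >= n m_A
     - z_A - z_S >= n N tau (1/8 - 2 delta). This is at least n N tau / 16 because delta <= 1/32. *)
  have := maxSw A AN.
  rewrite [X in n%:R * X - _]mean_sum in leA.
  have : n%:R * (tau * (N%:R / 8)) <= n%:R * (tau * #|A :&: G|%:R).
    by rewrite !ler_wpM2l.
  have : delta * n%:R * N%:R * tau <= 32^-1 * n%:R * N%:R * tau.
    by rewrite !ler_wpM2r.
  move=> h1 h2 h3.
  rewrite -(ler_pM2l nR0).
  have {}nA := nA isT; have {}nS := nS isT.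
  lra.
rewrite lee_fin lerD2r lerD2l card_draws card_ord.
apply: ler_pM; rewrite ?mulr_ge0 ?exprn_ge0 ?expR_ge0//.
  by rewrite ler_wpM2l ?exprn_ge0// -natrX ler_nat bin_le_expn.
rewrite ler_expR lerN2 natrM le_eqVlt; apply/orP; left; apply/eqP; field.
by rewrite !gt_eqF.
Qed.

End Bounds.

(** * Growth of powers, union bounds in exponential form, and the size N *)

Section Asymptotics.
Context {R : realType}.
Implicit Types (a b c delta B : R).

Lemma near_powR_ge a B : 0 < a -> \forall p \near \oo, B <= (p%:R : R) `^ a.
Proof.
move=> a0; have [B0|B0] := leP B 0.
  by apply: nearW => p; exact: le_trans (powR_ge0 _ _).
near=> p.
have -> : B = (B `^ a^-1) `^ a by rewrite -powRrM mulVf ?gt_eqF// powRr1// ltW.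
apply: ge0_ler_powR; rewrite ?nnegrE ?powR_ge0 ?(ltW a0)//.
by near: p; exact: nbhs_infty_ger.
Unshelve. all: by end_near. Qed.

Lemma near_ln_le_powR c B : 0 < c -> 0 < B ->
  \forall p \near \oo, ln (p%:R : R) <= B * (p%:R : R) `^ c.
Proof.
move=> c0 B0; have c20 : 0 < c / 2 by rewrite divr_gt0.
near=> p.
have p0 : 0 < p%:R :> R by rewrite ltr0n; near: p; exact: nbhs_infty_gt.
(* With x = p^(c/2), ln p = (2/c) ln x <= (2/c) x, and 2/c <= B x for large p, so ln p <= B x^2. *)
set x := (p%:R : R) `^ (c / 2).
have x0 : 0 < x by exact: powR_gt0.
have -> : (p%:R : R) `^ c = x * x.
  rewrite -powRD; last by apply/implyP => _; rewrite gt_eqF.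
  by congr (_ `^ _); field.
have lnE : ln p%:R = 2 / c * ln x.
  by rewrite ln_powR mulrA; field; rewrite gt_eqF.
rewrite lnE; apply: (@le_trans _ _ (2 / c * x)).
  by rewrite ler_wpM2l ?divr_ge0 ?(ltW c0)// ltW// ln_sublinear.
rewrite mulrA ler_wpM2r ?(ltW x0)// -ler_pdivrMl// /x.
by near: p; exact: near_powR_ge.
Unshelve. all: by end_near. Qed.

Lemma expRN_le (delta x : R) :
  0 < delta -> delta^-1 <= x -> expR (- x) <= delta.
Proof.
move=> delta0 dx; have x0 : 0 < x by apply: lt_le_trans dx; rewrite invr_gt0.
rewrite expRN -[leRHS]invrK lef_pV2 ?posrE ?expR_gt0 ?invr_gt0//.
apply: (le_trans dx); apply: le_trans (expR_ge1Dx x); lra.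
Qed.

Lemma expr2_le_expR (n : nat) : 2 ^+ n <= expR (n%:R : R).
Proof.
rewrite -[n%:R]mulr1 expRM_natl lerXn2r ?nnegrE ?expR_ge0//.
exact: (expR_ge1Dx 1).
Qed.

Lemma cvge0_le (u : nat -> \bar R) : (forall p, 0 <= u p)%E ->
  (forall e : R, 0 < e -> \forall p \near \oo, (u p <= e%:E)%E) ->
  u p @[p --> \oo] --> 0%E.
Proof.
move=> u0 ule; apply/fine_cvgP; split.
  apply: filterS (ule 1 ltr01) => p up.
  by rewrite ge0_fin_numE// (le_lt_trans up)// ltry.
apply/cvgrPdist_le => e e0; apply: filterS (ule e e0) => p up.
rewrite sub0r normrN ger0_norm ?fine_ge0//= -lee_fin fineK//.
by rewrite ge0_fin_numE// (le_lt_trans up)// ltry.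
Qed.

(** The bound on Q makes the exponent at least 2n; one n absorbs 2^n <= e^n, and the other leaves
    e^(-n) <= delta. *)
Lemma union_bound_labels (n : nat) (delta Q : R) : 0 < delta ->
  delta^-1 <= n%:R -> 4 * delta ^- 2 <= Q ->
  2 ^+ n * expR (- (delta ^+ 2 * n%:R * Q / 2)) <= delta.
Proof.
move=> delta0 dn dQ.
have dQ4 : 4 <= delta ^+ 2 * Q.
  by rewrite -ler_pdivrMl ?exprn_gt0// mulrC.
apply: le_trans (expRN_le delta0 dn).
apply: (@le_trans _ _ (expR n%:R * expR (- (delta ^+ 2 * n%:R * Q / 2)))).
  by rewrite ler_wpM2r ?expR_ge0// expr2_le_expR.
rewrite -expRD ler_expR.
have : 4 * n%:R <= (delta ^+ 2 * Q) * n%:R by rewrite ler_wpM2r.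
lra.
Qed.

(** With x = delta^2 n N t2, the hypotheses give n <= x/6 and N ln p <= x/6. Hence 2n + N ln p <=
    x/2, and the whole product is at most e^(-n) <= delta. *)
Lemma union_bound_labels_subsets (n N p : nat) (delta t2 : R) : (0 < p)%N ->
  0 < delta -> delta^-1 <= n%:R -> 6 * delta ^- 2 <= N%:R * t2 ->
  6 * delta ^- 2 * ln p%:R <= n%:R * t2 ->
  2 ^+ n * p%:R ^+ N * expR (- (delta ^+ 2 * n%:R * (N%:R * t2) / 2)) <= delta.
Proof.
move=> p0 delta0 dn dN dp.
have d2 : 0 < delta ^+ 2 by rewrite exprn_gt0.
have dN6 : 6 <= delta ^+ 2 * (N%:R * t2) by rewrite -ler_pdivrMl// mulrC.
have dp6 : 6 * ln p%:R <= delta ^+ 2 * (n%:R * t2).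
  by rewrite -ler_pdivrMl// mulrCA mulrA.
have pE : p%:R ^+ N = expR (N%:R * ln p%:R) :> R.
  by rewrite expRM_natl lnK// posrE ltr0n.
apply: le_trans (expRN_le delta0 dn).
apply: (@le_trans _ _ (expR n%:R * p%:R ^+ N *
    expR (- (delta ^+ 2 * n%:R * (N%:R * t2) / 2)))).
  by rewrite ler_wpM2r ?expR_ge0// ler_wpM2r ?exprn_ge0// expr2_le_expR.
rewrite pE -!expRD ler_expR.
have : 6 * n%:R <= (delta ^+ 2 * (N%:R * t2)) * n%:R by rewrite ler_wpM2r.
have : N%:R * (6 * ln p%:R) <= N%:R * (delta ^+ 2 * (n%:R * t2)).
  by rewrite ler_wpM2l.
lra.
Qed.

Lemma sparse_size_ge (beta : R) (p : nat) :
  p%:R * arw_eps beta p <= (sparse_size beta p)%:R.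
Proof.
have x0 : 0 <= p%:R * arw_eps beta p by rewrite mulr_ge0 ?powR_ge0.
rewrite /sparse_size natr_absz ger0_norm; first exact: ceil_ge.
by rewrite ceil_ge0 (lt_le_trans _ x0).
Qed.

Lemma sparse_size_lt (beta : R) (p : nat) :
  (sparse_size beta p)%:R < p%:R * arw_eps beta p + 1.
Proof.
have x0 : 0 <= p%:R * arw_eps beta p by rewrite mulr_ge0 ?powR_ge0.
rewrite /sparse_size natr_absz ger0_norm; last first.
  by rewrite ceil_ge0 (lt_le_trans _ x0).
by rewrite -ltrBlDr -[X in _ - X]/(1%:~R) -rmorphB; exact: ceilB1_lt.
Qed.

Lemma sparse_size_leq (beta : R) (p : nat) : 0 <= beta -> (0 < p)%N ->
  (sparse_size beta p <= p)%N.
Proof.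
move=> beta0 p0; have p1 : 1 <= p%:R :> R by rewrite ler1n.
have x0 : 0 <= p%:R * arw_eps beta p by rewrite mulr_ge0 ?powR_ge0.
rewrite -lez_nat /sparse_size gez0_abs ?ceil_ge0 ?(lt_le_trans _ x0)//.
rewrite ceil_le_int -[leRHS]mulr1 ler_wpM2l//.
by rewrite -(powRr0 p%:R) ler_powR// oppr_le0.
Qed.

End Asymptotics.

(** * Positivity of the exponents below the curve, and the limits *)

Theorem theorem1p2 (R : realType) (theta beta alpha : R)
  (theta_gt0 : 0 < theta) (theta_lt1 : theta < 1)
  (beta_gt0 : 0 < beta) (beta_lt1 : beta < 1)
  (alpha_gt0 : 0 < alpha) (alpha_lt : alpha < eta_clu theta beta)
  (n : nat -> nat)
  (* n p is p ^ theta, rounded to an integer in either direction *)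
  (n_round : forall p : nat, `|(n p)%:R - p%:R `^ theta| < 1)
  (d : nat -> measure_display) (T : forall p : nat, measurableType (d p))
  (P : forall p : nat, probability (T p) R)
  (M : forall p : nat,
     arw_model (P p) (n p) p (arw_eps beta p) (arw_tau alpha p)) :
  (0 < beta -> beta < (1 - theta) / 2 ->
     hamm (M p) (fun w => simple_agg (arw_data (M p) w)) @[p --> \oo] --> 0%E)
  /\
  ((1 - theta) / 2 < beta -> beta < 1 ->
     forall S : forall p : nat, T p -> {set 'I_p},
       (forall (p : nat) (A : {set 'I_p}), measurable [set w | S p w = A]) ->
       (forall (p : nat) (w : T p),
          sparse_maximizer (sparse_size beta p) (arw_data (M p) w) (S p w)) ->
     hamm (M p) (fun w => sparse_agg (S p w) (arw_data (M p) w))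
       @[p --> \oo] --> 0%E).
Proof.
have powD (x r s : R) : 0 < x -> x `^ (r + s) = x `^ r * x `^ s.
  by move=> x0; rewrite powRD//; apply/implyP => _; rewrite gt_eqF.
have pepsE p : (0 < p)%N -> p%:R * arw_eps beta p = p%:R `^ (1 - beta).
  by move=> p0; rewrite powD ?ltr0n// powRr1.
have tau2E p : (0 < p)%N -> arw_tau alpha p ^+ 2 = p%:R `^ (- (2 * alpha)).
  move=> p0; rewrite expr2 -powD ?ltr0n//; congr (_ `^ _); lra.
have n_ge p : p%:R `^ theta - 1 <= (n p)%:R.
  by have := n_round p; rewrite ltr_norml => /andP[]; lra.
have beta1 : 0 < 1 - beta by rewrite subr_gt0.
split=> [_ beta_lt|beta_gt _ S mS maxS].
  (* This is the first branch of the curve, and the exponent of p eps^2 tau^2. *)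
  have c0 : 0 < 1 - 2 * beta - 2 * alpha.
    by move: alpha_lt; rewrite /eta_clu ifT ?(ltW beta_lt)//; lra.
  apply: cvge0_le => [p|e e0]; first exact: hamm_ge0.
  (* The bound has three terms, at most 4 delta, delta and delta. *)
  have [delta delta0 ->] : exists2 delta, 0 < delta & e = 6 * delta.
    by exists (e / 6); [rewrite divr_gt0|field].
  near=> p.
  have p0 : (0 < p)%N by near: p; exact: nbhs_infty_gt.
  have pR0 : 0 < p%:R :> R by rewrite ltr0n.
  have np : delta^-1 <= (n p)%:R.
    apply: le_trans (n_ge p); rewrite lerBrDr.
    by near: p; exact: near_powR_ge.
  apply: (le_trans (hamm_simple_agg_le (M p) p0 (powR_gt0 _ pR0)
    (powR_gt0 _ pR0) delta0)).
  rewrite lee_fin [leRHS](_ : _ = 4 * delta + delta + delta); last by ring.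
  apply: lerD; first (rewrite lerD2l; apply: union_bound_labels => //).
    have -> : p%:R * arw_eps beta p * (arw_eps beta p * arw_tau alpha p ^+ 2) =
        p%:R `^ (1 - 2 * beta - 2 * alpha).
      by rewrite pepsE// tau2E// -!powD//; congr (_ `^ _); ring.
    by near: p; exact: near_powR_ge.
  apply: expRN_le => //; rewrite pepsE// ler_pdivlMr//.
  by near: p; exact: near_powR_ge.
(* For beta > (1 - theta)/2 the curve is the minimum of theta/2 and (1 - beta)/2. The two exponents
   are those of p eps tau^2 and n tau^2. *)
have [c10 c20] : 0 < 1 - beta - 2 * alpha /\ 0 < theta - 2 * alpha.
  move: alpha_lt; rewrite /eta_clu ifF; last by apply/negbTE; rewrite -ltNge.
  by case: (leP beta (1 - theta)) => ? ?; split; lra.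
apply: cvge0_le => [p|e e0]; first exact: hamm_ge0.
(* Here 18 = 16 + 1 + 1 counts the three error terms, and 1/32 is the cap needed for comparing with
   the maximizer. *)
have [delta /andP[delta0 delta32] delta_e] :
    exists2 delta, 0 < delta <= 32^-1 & 18 * delta <= e.
  exists (Num.min (e / 18) 32^-1).
    by rewrite lt_min ge_min lexx orbT invr_gt0 divr_gt0// ltr0n.
  by rewrite mulrC -ler_pdivlMr// ge_min lexx.
have B0 : 0 < delta ^+ 2 / 12 by rewrite divr_gt0// exprn_gt0.
near=> p.
have p0 : (0 < p)%N by near: p; exact: nbhs_infty_gt.
have pR0 : 0 < p%:R :> R by rewrite ltr0n.
have p1 : 1 <= p%:R :> R by rewrite ler1n.
have np : delta^-1 <= (n p)%:R.
  apply: le_trans (n_ge p); rewrite lerBrDr.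
  by near: p; exact: near_powR_ge.
have np0 : (0 < n p)%N.
  by rewrite -(ltr0n R) (lt_le_trans _ np)// invr_gt0.
have np2 : p%:R `^ theta / 2 <= (n p)%:R.
  apply: le_trans (n_ge p).
  suff : 2 <= p%:R `^ theta by lra.
  by near: p; exact: near_powR_ge.
have pe1 : 1 <= p%:R * arw_eps beta p.
  by rewrite pepsE//; near: p; exact: near_powR_ge.
have N0 : (0 < sparse_size beta p)%N.
  rewrite -(ltr0n R) (lt_le_trans _ (sparse_size_ge _ _))//.
  by rewrite (lt_le_trans _ pe1).
(* The ceiling adds less than 1, which is at most p eps for large p. *)
have Npe : (sparse_size beta p)%:R <= 2 * (p%:R * arw_eps beta p).
  by have := sparse_size_lt beta p; lra.
have Np : (0 < sparse_size beta p <= p)%N by rewrite N0 sparse_size_leq// ltW.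
have delta_bnd : 0 < delta <= 32^-1 by rewrite delta0.
have tau0 : 0 < arw_tau alpha p by exact: powR_gt0.
apply: (le_trans (hamm_sparse_maximizer_le np0 Np Npe tau0 delta_bnd (mS p)
  (maxS p))).
rewrite lee_fin; apply: le_trans delta_e.
rewrite [leRHS](_ : _ = 16 * delta + delta + delta); last by ring.
apply: lerD; first (rewrite lerD2l; apply: union_bound_labels_subsets => //).
- rewrite tau2E//; apply: (@le_trans _ _ (p%:R `^ (1 - beta - 2 * alpha))).
    by near: p; exact: near_powR_ge.
  by rewrite powD// ler_wpM2r ?powR_ge0// -pepsE// sparse_size_ge.
- rewrite tau2E//.
  apply: (@le_trans _ _ (p%:R `^ theta / 2 * p%:R `^ (- (2 * alpha))));
    last by rewrite ler_wpM2r ?powR_ge0.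
  rewrite [leRHS]mulrAC -powD//.
  (* The 12 is the 6 of the union bound times the 2 lost in n >= p^theta / 2. *)
  have lnp : ln p%:R <= delta ^+ 2 / 12 * p%:R `^ (theta - 2 * alpha).
    by near: p; exact: near_ln_le_powR.
  have d0 : delta != 0 by rewrite gt_eqF.
  rewrite [leRHS](_ : _ = 6 * delta ^- 2 *
      (delta ^+ 2 / 12 * p%:R `^ (theta - 2 * alpha))); last by field.
  by rewrite ler_wpM2l// mulr_ge0// invr_ge0 sqr_ge0.
apply: expRN_le => //; rewrite pepsE// ler_pdivlMr//.
by near: p; exact: near_powR_ge.
Unshelve. all: by end_near. Qed.
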